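(* Let $\sigma\in C([0,\infty);\mathbb{R})$. Define $$\Sigma(t)=\left(\int_0^te^{-2(t-s)}\sigma^2(s)\,ds\right)^{1/2}(\log t)^{1/2}\quad(t\ge1),$$ $$\theta^2(n)=\int_n^{n+1}\sigma^2(s)\,ds,\ \ \theta(n)\ge0\quad(n\ge0),\qquad \Theta^2(n)=\sum_{j=0}^{n-1}e^{-2(n-j)}\theta^2(j)\quad(n\ge1),$$ and, for $\epsilon>0$, $S'(\epsilon)=\sum_{n=0}^\infty\theta(n)\exp\left(-\frac{\epsilon^2}{2}\frac1{\theta^2(n)}\right)$. (i) The following are equivalent: (A) $\lim_{t\to\infty}\Sigma^2(t)=0$; (B) $\lim_{n\to\infty}\Sigma^2(n)=0$; (C) $\lim_{n\to\infty}\theta^2(n)\log n=0$. Moreover, all imply that $S'(\epsilon)<+\infty$ for all $\epsilon>0$. (ii) The following are equivalent: (A) $\limsup_{t\to\infty}\Sigma^2(t)\in(0,\infty)$; (B) $\limsup_{n\to\infty}\Sigma^2(n)\in(0,\infty)$; (C) $\limsup_{n\to\infty}\theta^2(n)\log n\in(0,\infty)$. Moreover, all imply that there exists $\epsilon'>0$ such that $S'(\epsilon)<+\infty$ for all $\epsilon>\epsilon'$. (iii) The following are equivalent: (A) $\liminf_{t\to\infty}\Sigma^2(t)\in(0,\infty)$; (B) $\liminf_{n\to\infty}\Sigma^2(n)\in(0,\infty)$; (C) $\liminf_{n\to\infty}\Theta^2(n)\log n\in(0,\infty)$. Moreover, all imply that $\liminf_{n\to\infty}\theta^2(n)\log n\in[0,\infty)$.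 (iv) The following are equivalent: (A) $\lim_{t\to\infty}\Sigma^2(t)=+\infty$; (B) $\lim_{n\to\infty}\Sigma^2(n)=+\infty$; (C) $\lim_{n\to\infty}\Theta^2(n)\log n=+\infty$. Moreover, all imply that $\limsup_{n\to\infty}\theta^2(n)\log n=\infty$.
   Context: Limits in $t$ are over real $t\to\infty$ and limits in $n$ over integers $n\to\infty$. In $S'(\epsilon)$ the summand is interpreted as $0$ when $\theta(n)=0$. *)

(* Defs.v *)
From mathcomp Require Export all_boot all_order all_algebra.
From mathcomp Require Export all_classical all_reals all_analysis.
Export Order.TTheory GRing.Theory Num.Theory.
Export numFieldNormedType.Exports.

Set Implicit Arguments.
Unset Strict Implicit.
Unset Printing Implicit Defensive.

Local Open Scope classical_set_scope.
Local Open Scope ring_scope.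

(* Only the values of sigma on [0, +oo[ are ever used. *)

(* Intended for t >= 1: in the library, ln x = 0 for x <= 0 and Num.sqrt is 0
   on negative numbers, so that Sigma takes the value 0 for t < 1. *)
Definition Sigma (R : realType) (sigma : R -> R) (t : R) : R :=
  Num.sqrt (\int[lebesgue_measure]_(s in `[0, t])
              (expR (- 2 * (t - s)) * sigma s ^+ 2))
  * Num.sqrt (ln t).

(* The nonnegative root of the integral of sigma^2 over [n, n+1]. *)
Definition theta (R : realType) (sigma : R -> R) (n : nat) : R :=
  Num.sqrt (\int[lebesgue_measure]_(s in `[n%:R, n.+1%:R]) (sigma s ^+ 2)).

(* The square Theta^2(n); Theta itself is never needed. *)
Definition Theta_sq (R : realType) (sigma : R -> R) (n : nat) : R :=
  \sum_(0 <= j < n) expR (- 2 * (n%:R - j%:R)) * theta sigma j ^+ 2.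

(* The series has nonnegative terms and is summed in [0, +oo]. *)
Definition Sprime (R : realType) (sigma : R -> R) (eps : R) : \bar R :=
  (\sum_(0 <= n <oo)
     (if theta sigma n == 0 then 0
      else theta sigma n *
           expR (- (eps ^+ 2 / 2) * (1 / theta sigma n ^+ 2)))%R%:E)%E.

(* Main.v *)
(* Write E t for the integral of exp(-2(t-s)) sigma(s)^2 over [0,t].  Splitting
   it at n gives E(n+1) = exp(-2) E(n) + I_n with
   exp(-2) theta^2(n) <= I_n <= theta^2(n), while Theta^2 solves the recursion
   Theta^2(n+1) = exp(-2) (Theta^2(n) + theta^2(n)); hence
   Theta^2(n) <= E(n) <= exp(2) Theta^2(n).  Also E loses at most the factor
   exp(-2) over a unit interval, so the values of Sigma^2 at a real t are squeezed,
   up to constants, between those at the neighbouring integers.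
   With x n = Theta^2(n) log n and y n = theta^2(n) log n, the bounds
   log(n+1) <= 2 log n and exp(-2) <= 1/4 turn the recursion into
   x(n+1) <= (x n + y n) / 2, whence limsup x <= 2 limsup y; conversely
   y n <= exp(2) x(n+1).  Finally, if y n <= M eventually and eps^2 >= 4 M, then
   the terms of S'(eps) are eventually at most 1/n^2. *)
Require Import Defs.
From mathcomp Require Import ring lra.

Set Implicit Arguments.
Unset Strict Implicit.
Unset Printing Implicit Defensive.

Local Open Scope classical_set_scope.
Local Open Scope ring_scope.

(** * Limsup, liminf and limits along a filter, restated as eventual bounds *)

Section limf.
Context {T : choiceType} {X : filteredType T} {R : realType}.
Context (F : set_system X) {FF : Filter F}.

Lemma limf_esup_near_le (f : X -> \bar R) (c : \bar R) :
  (\forall x \near F, (f x <= c)%E) -> (limf_esup f F <= c)%E.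
Proof.
move=> fc; apply: (@le_trans _ _ (ereal_sup (f @` [set x | (f x <= c)%E]))).
  by apply: ereal_inf_lbound; exists [set x | (f x <= c)%E].
by apply: ge_ereal_sup => _ [x /= fxc <-].
Qed.

Lemma near_le_limf_esup (f : X -> \bar R) (c : \bar R) :
  (limf_esup f F < c)%E -> \forall x \near F, (f x <= c)%E.
Proof.
move=> /ereal_inf_lt[_ [V FV <-] /ltW Vc]; apply: filterS FV => x Vx.
by apply: le_trans Vc; apply: ereal_sup_ubound; exists x.
Qed.

Lemma limf_einf_near_ge (f : X -> \bar R) (c : \bar R) :
  (\forall x \near F, (c <= f x)%E) -> (c <= limf_einf f F)%E.
Proof.
move=> cf; rewrite /limf_einf leeNr; apply: limf_esup_near_le.
by apply: filterS cf => x; rewrite leeN2.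
Qed.

Lemma near_ge_limf_einf (f : X -> \bar R) (c : \bar R) :
  (c < limf_einf f F)%E -> \forall x \near F, (c <= f x)%E.
Proof.
rewrite /limf_einf lteNr => /near_le_limf_esup.
by apply: filterS => x; rewrite leeN2.
Qed.

Variable f : X -> R.

(** Asking for [0 < M] costs nothing, covers a limsup equal to -oo, and lets the bound be rescaled
    by a dominance. *)
Lemma limf_esup_ltyP : (limf_esup (fun x => (f x)%:E) F < +oo)%E <->
  exists2 M, 0 < M & \forall x \near F, f x <= M.
Proof.
split=> [fy|[M _ fM]]; last first.
  by apply: le_lt_trans (ltry M); exact: limf_esup_near_le.
have [M M0 fM] : exists2 M, 0 < M & (limf_esup (fun x => (f x)%:E) F < M%:E)%E.
  case: limf_esup fy => [r _|//|_]; last by exists 1; rewrite ?ltNyr.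
  exists (`|r| + 1); first by rewrite ltr_wpDl.
  by rewrite lte_fin (le_lt_trans (ler_norm r))// ltrDl.
by exists M => //; apply: filterS (near_le_limf_esup fM) => x; rewrite lee_fin.
Qed.

(** The negated condition is the one that [cvg_ge0_0P] gives for convergence to 0, so (i) and (ii)
    share one transfer argument. [limf_einf_ltyP] and [cvgry_gt0P] play the same roles for (iii) and
    (iv). *)
Lemma limf_esup_gt0P : (0 < limf_esup (fun x => (f x)%:E) F)%E <->
  ~ forall c, 0 < c -> \forall x \near F, f x <= c.
Proof.
split=> [f0 fc|]; last first.
  move=> fc; rewrite ltNge; apply/negP => f0; apply: fc => c c0.
  have /near_le_limf_esup : (limf_esup (fun x => (f x)%:E) F < c%:E)%E.
    by apply: le_lt_trans f0 _; rewrite lte_fin.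
  by apply: filterS => x; rewrite lee_fin.
have : (limf_esup (fun x => (f x)%:E) F <= 0)%E.
  apply/lee_addgt0Pr => e e0; rewrite add0e; apply: limf_esup_near_le.
  exact: fc.
by rewrite leNgt f0.
Qed.

Lemma limf_einf_gt0P : (0 < limf_einf (fun x => (f x)%:E) F)%E <->
  exists2 c, 0 < c & \forall x \near F, c <= f x.
Proof.
split=> [f0|[c c0 cf]]; last first.
  apply: (@lt_le_trans _ _ c%:E); first by rewrite lte_fin.
  by apply: limf_einf_near_ge; apply: filterS cf => x; rewrite lee_fin.
have [c c0 cf] : exists2 c, 0 < c & (c%:E < limf_einf (fun x => (f x)%:E) F)%E.
  case: limf_einf f0 => [r|_|//]; last by exists 1; rewrite ?ltry.
  by rewrite lte_fin => r0; exists (r / 2); rewrite ?lte_fin; lra.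
by exists c => //; apply: filterS (near_ge_limf_einf cf) => x; rewrite lee_fin.
Qed.

Lemma limf_einf_ltyP : (limf_einf (fun x => (f x)%:E) F < +oo)%E <->
  ~ forall M, 0 < M -> \forall x \near F, M <= f x.
Proof.
split=> [fy fM|fM]; last first.
  rewrite ltNge; apply/negP => fy; apply: fM => M _.
  have /near_ge_limf_einf : (M%:E < limf_einf (fun x => (f x)%:E) F)%E.
    exact: lt_le_trans (ltry M) fy.
  by apply: filterS => x; rewrite lee_fin.
have {}fM M : 0 < M -> (M%:E <= limf_einf (fun x => (f x)%:E) F)%E.
  move=> /fM {}fM; apply: limf_einf_near_ge.
  by apply: filterS fM => x; rewrite lee_fin.
case: limf_einf fy fM => [r|//|] _ fM; last by have := fM 1 ltr01.
have : 0 < `|r| + 1 by rewrite ltr_wpDl.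
by move=> /fM; rewrite lee_fin leNgt (le_lt_trans (ler_norm r))// ltrDl.
Qed.

Lemma cvg_ge0_0P : (\forall x \near F, 0 <= f x) ->
  f x @[x --> F] --> 0 <-> forall c, 0 < c -> \forall x \near F, f x <= c.
Proof.
move=> f0; split=> [/cvgrPdist_le fc c /fc|fc].
  by apply: filterS => x; rewrite sub0r normrN; exact: le_trans (ler_norm _).
apply/cvgrPdist_le => e /fc; apply: filterS2 f0 => x f0 fe.
by rewrite sub0r normrN ger0_norm.
Qed.

Lemma cvgry_gt0P :
  f x @[x --> F] --> +oo <-> forall M, 0 < M -> \forall x \near F, M <= f x.
Proof.
split=> [/cvgryPge fM M _|fM]; first exact: fM.
apply/cvgryPge => M; have : 0 < `|M| + 1 by rewrite ltr_wpDl.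
move=> /fM; apply: filterS => x; apply: le_trans.
by rewrite (le_trans (ler_norm M))// lerDl.
Qed.

Lemma limf_esup_gt0_ltyP : (0 < limf_esup (fun x => (f x)%:E) F < +oo)%E <->
  ~ (forall c, 0 < c -> \forall x \near F, f x <= c) /\
  exists2 M, 0 < M & \forall x \near F, f x <= M.
Proof. by rewrite -limf_esup_gt0P -limf_esup_ltyP; split=> [/andP|/andP]. Qed.

Lemma limf_einf_gt0_ltyP : (0 < limf_einf (fun x => (f x)%:E) F < +oo)%E <->
  (exists2 c, 0 < c & \forall x \near F, c <= f x) /\
  ~ forall M, 0 < M -> \forall x \near F, M <= f x.
Proof. by rewrite -limf_einf_gt0P -limf_einf_ltyP; split=> [/andP|/andP]. Qed.

End limf.

(** * Dominance up to a constant, and the asymptotic properties it transfers *)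

Section dominance.
Context {R : realType} {X Y : Type}.
Implicit Types (F : set_system X) (G : set_system Y) (f : X -> R) (g : Y -> R).

(* Up to the factor K, an eventual bound above on g transfers to f, which says
   that limsup f <= K * limsup g (for g >= 0) without mentioning the limits. *)
Definition limsup_dominated F f G g := exists2 K : R, 0 < K &
  forall c, 0 < c -> (\forall y \near G, g y <= c) ->
    \forall x \near F, f x <= K * c.

(* liminf g >= K * liminf f. *)
Definition liminf_dominated F f G g := exists2 K : R, 0 < K &
  forall c, 0 < c -> (\forall x \near F, c <= f x) ->
    \forall y \near G, K * c <= g y.

End dominance.

Section dominance_lemmas.
Context {R : realType} {X Y : choiceType}.
Context (F : set_system X) {FF : Filter F} (G : set_system Y) {FG : Filter G}.
Variables (f : X -> R) (g : Y -> R).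

Lemma limsup_dominated_lim0 : limsup_dominated F f G g ->
  (forall c, 0 < c -> \forall y \near G, g y <= c) ->
  forall c, 0 < c -> \forall x \near F, f x <= c.
Proof.
move=> [K K0 fg] g0 c c0; have := fg _ (divr_gt0 c0 K0) (g0 _ (divr_gt0 c0 K0)).
by rewrite mulrC divfK ?gt_eqF.
Qed.

Lemma limsup_dominated_bounded : limsup_dominated F f G g ->
  (exists2 M, 0 < M & \forall y \near G, g y <= M) ->
  exists2 M, 0 < M & \forall x \near F, f x <= M.
Proof.
by move=> [K K0 fg] [M M0 /(fg _ M0)]; exists (K * M); rewrite ?mulr_gt0.
Qed.

Lemma liminf_dominated_pos : liminf_dominated F f G g ->
  (exists2 c, 0 < c & \forall x \near F, c <= f x) ->
  exists2 c, 0 < c & \forall y \near G, c <= g y.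
Proof.
by move=> [K K0 fg] [c c0 /(fg _ c0)]; exists (K * c); rewrite ?mulr_gt0.
Qed.

Lemma liminf_dominated_limy : liminf_dominated F f G g ->
  (forall M, 0 < M -> \forall x \near F, M <= f x) ->
  forall M, 0 < M -> \forall y \near G, M <= g y.
Proof.
move=> [K K0 fg] fM M M0; have := fg _ (divr_gt0 M0 K0) (fM _ (divr_gt0 M0 K0)).
by rewrite mulrC divfK ?gt_eqF.
Qed.

End dominance_lemmas.

Section equivalences.
Context {R : realType} {X Y : choiceType}.
Context (F : set_system X) {FF : Filter F} (G : set_system Y) {FG : Filter G}.
Variables (f : X -> R) (g : Y -> R).

(** Each implication uses both dominances: one carries the upper bound forward, the other carries
    convergence to 0 backward, hence its failure forward. *)
Lemma limsup_dominated_pos_bounded :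
  limsup_dominated F f G g -> limsup_dominated G g F f ->
  (~ (forall c, 0 < c -> \forall x \near F, f x <= c) /\
   exists2 M, 0 < M & \forall x \near F, f x <= M) <->
  (~ (forall c, 0 < c -> \forall x \near G, g x <= c) /\
   exists2 M, 0 < M & \forall x \near G, g x <= M).
Proof.
move=> fg gf; split=> -[n0 bd]; split;
  try exact: limsup_dominated_bounded bd;
  by move=> l0; apply: n0; exact: limsup_dominated_lim0 l0.
Qed.

Lemma liminf_dominated_pos_bounded :
  liminf_dominated F f G g -> liminf_dominated G g F f ->
  ((exists2 c, 0 < c & \forall x \near F, c <= f x) /\
   ~ forall M, 0 < M -> \forall x \near F, M <= f x) <->
  ((exists2 c, 0 < c & \forall x \near G, c <= g x) /\
   ~ forall M, 0 < M -> \forall x \near G, M <= g x).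
Proof.
move=> fg gf; split=> -[pos ny]; split;
  try exact: liminf_dominated_pos pos;
  by move=> ly; apply: ny; exact: liminf_dominated_limy ly.
Qed.

End equivalences.

(** * Real sequences: an averaging recursion and comparison with the series of 1/n^2 *)

Section averaging.
Context {R : realType}.
Implicit Types x y : R^nat.

Lemma near_S (P : nat -> Prop) :
  (\forall n \near \oo, P n) -> \forall n \near \oo, P n.+1.
Proof. by move=> [N _ NP]; exists N => // n /= /leqW /NP. Qed.

(** Once [y n <= c], the recursion at least halves the excess: x(n+1) - c <= (x n - c) / 2. The
    excess therefore falls below any positive level, in particular below c. *)
Lemma averaging_near_le x y (c : R) : 0 < c ->
  (\forall n \near \oo, x n.+1 <= (x n + y n) / 2) ->
  (\forall n \near \oo, y n <= c) -> \forall n \near \oo, x n <= 2 * c.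
Proof.
move=> c0 xy yc; have [N _ Nxy] : \forall n \near \oo,
    x n.+1 <= (x n + y n) / 2 /\ y n <= c by apply: filterS2 xy yc.
have step k : x (N + k)%N - c <= `|x N| / 2 ^+ k.
  elim: k => [|k IHk].
    by rewrite addn0 expr0 divr1 (le_trans _ (ler_norm _))// gerBl ltW.
  have [|xS yS] := Nxy (N + k)%N; first exact: leq_addr.
  rewrite addnS exprSr invfM mulrA; lra.
(* Since 2^k > k, waiting [k0] steps after [N] brings [|x N| / 2 ^+ k] down to at most c. *)
have [k0 xk0] : exists k0 : nat, `|x N| / c <= k0%:R.
  by exists (Num.truncn (`|x N| / c)).+1; rewrite ltW// truncnS_gt.
exists (N + k0)%N => // n /= nk.
have nN : (N <= n)%N by rewrite (leq_trans _ nk)// leq_addr.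
have := step (n - N)%N; rewrite subnKC// => h.
suff : `|x N| / 2 ^+ (n - N) <= c by lra.
rewrite ler_pdivrMr ?exprn_gt0// mulrC -ler_pdivrMr// (le_trans xk0)//.
rewrite -natrX ler_nat (leq_trans _ (ltnW (ltn_expl _ _)))//.
by rewrite leq_subRL.
Qed.

End averaging.

Lemma nneseries_near_le_invsq (R : realType) (u : R^nat) :
  (forall n, 0 <= u n) -> (\forall n \near \oo, u n <= n%:R ^- 2) ->
  (\sum_(0 <= n <oo) (u n)%:E < +oo)%E.
Proof.
move=> u0 [N _ Nu].
pose S n := \sum_(0 <= i < n) u i.
have SS m : S m.+1 = S m + u m by rewrite /S big_nat_recr.
(* Telescoping: starting at [N.+2] makes the index at least k+2, so the term is at most
   1/((k+1)(k+2)) = 1/(k+1) - 1/(k+2). The subtracted 1/(k+1) is what lets the induction close. *)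
have SN k : S (N.+2 + k)%N <= S N.+2 + 1 - (k.+1)%:R^-1.
  elim: k => [|k IHk]; first by rewrite addn0 invr1 addrK.
  rewrite addnS SS.
  have : u (N.+2 + k)%N <= k.+1%:R^-1 - k.+2%:R^-1.
    apply: (le_trans (Nu _ _)) => /=; first by rewrite !addSn -!addnS leq_addr.
    apply: (@le_trans _ _ (k.+1%:R * k.+2%:R)^-1).
      rewrite lef_pV2 ?posrE ?exprn_gt0 ?mulr_gt0 ?ltr0n// expr2 ler_pM//.
        by rewrite ler_nat !addSn ltnS (leq_trans (leq_addl N k)).
      by rewrite ler_nat !addSn !ltnS leq_addl.
    rewrite -[k.+2%:R]natr1 le_eqVlt; apply/orP; left; apply/eqP; field.
    have k0 : 0 <= k%:R :> R by exact: ler0n.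
    by rewrite !lt0r_neq0//; lra.
  by move=> uk; rewrite (le_trans (lerD IHk uk))// addrA subrK.
apply: (@le_lt_trans _ _ (S N.+2 + 1)%:E); last exact: ltry.
apply: lime_le; first by apply: is_cvg_nneseries => n _ _; rewrite lee_fin.
exists N.+2 => // n /= Nn; rewrite sumEFin lee_fin -/(S n).
rewrite -(subnKC Nn); apply: le_trans (SN _) _.
by rewrite gerBl invr_ge0.
Qed.


(** * The weighted integral of sigma^2 and its comparison with [Theta_sq] *)

Lemma within_continuousM {T : topologicalType} {K : numFieldType} (A : set T)
    (f g : T -> K) :
  {within A, continuous f} -> {within A, continuous g} ->
  {within A, continuous (f \* g)}.
Proof. by move=> cf cg x; apply: cvgM; [exact: cf|exact: cg]. Qed.

Section energy.
Context (R : realType).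
Notation mu := (@lebesgue_measure R).

Lemma within_itv0y_integrable (f : R -> R) (a b : R) :
  {within `[0, +oo[, continuous f} -> 0 <= a ->
  mu.-integrable `[a, b] (EFin \o f).
Proof.
move=> cf a0; apply: continuous_compact_integrable.
  exact: segment_compact.
apply: continuous_subspaceW cf => x /=; rewrite !in_itv/= andbT => /andP[ax _].
exact: le_trans ax.
Qed.

Lemma Rintegral_itv_cat (f : R -> R) (a b c : R) :
  mu.-integrable `[a, c] (EFin \o f) -> a <= b -> b <= c ->
  \int[mu]_(s in `[a, c]) f s =
  \int[mu]_(s in `[a, b]) f s + \int[mu]_(s in `[b, c]) f s.
Proof.
move=> fi ab bc; apply/eqP; rewrite addrC -subr_eq; apply/eqP.
(* The difference is an integral over a half-open interval, whose missing endpoint is null. *)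
rewrite Rintegral_itvB ?bnd_simp// Rintegral_itv_obnd_cbnd//.
apply: integrableS fi => //; apply: subset_itvr; rewrite bnd_simp; exact: ab.
Qed.

Variable sigma : R -> R.
Hypothesis sigma_cont : {within `[0, +oo[, continuous sigma}.

(** The solution of E' = -2 E + sigma^2, E(0) = 0, given by variation of constants. *)
Definition energy (t : R) : R :=
  \int[mu]_(s in `[0, t]) (expR (- 2 * (t - s)) * sigma s ^+ 2).

Lemma sqr_sigma_cont : {within `[0, +oo[, continuous (fun s => sigma s ^+ 2)}.
Proof.
exact: (within_continuousM sigma_cont sigma_cont).
Qed.

Lemma weighted_sqr_sigma_cont (t : R) :
  {within `[0, +oo[, continuous (fun s => expR (- 2 * (t - s)) * sigma s ^+ 2)}.
Proof.
apply: (within_continuousM _ sqr_sigma_cont).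
apply: continuous_subspaceT => s.
apply: continuous_comp; last exact: continuous_expR.
by apply: cvgM; [exact: cvg_cst|apply: cvgB; [exact: cvg_cst|exact: cvg_id]].
Qed.

Lemma energy_ge0 t : 0 <= energy t.
Proof. by apply: Rintegral_ge0 => s _; rewrite mulr_ge0 ?expR_ge0 ?sqr_ge0. Qed.

(** On [0, a] the weight factors as exp(-2(b-s)) = exp(-2(b-a)) exp(-2(a-s)). *)
Lemma energy_split (a b : R) : 0 <= a -> a <= b ->
  energy b = expR (- 2 * (b - a)) * energy a +
    \int[mu]_(s in `[a, b]) (expR (- 2 * (b - s)) * sigma s ^+ 2).
Proof.
move=> a0 ab; rewrite /energy (@Rintegral_itv_cat _ 0 a b)//; last first.
  by apply: within_itv0y_integrable => //; exact: weighted_sqr_sigma_cont.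
congr (_ + _); rewrite -RintegralZl//; last first.
  by apply: within_itv0y_integrable => //; exact: weighted_sqr_sigma_cont.
by apply: eq_Rintegral => s _; rewrite mulrA -expRD; congr (expR _ * _); ring.
Qed.

Lemma expR_decay (a s b : R) : a <= s -> s <= b ->
  expR (- 2 * (b - a)) <= expR (- 2 * (b - s)) <= 1.
Proof. by move=> as_ sb; rewrite ler_expR expR_le1; apply/andP; split; lra. Qed.

(** The middle term is the integral over [a, b] left by [energy_split], where the weight lies
    between exp(-2(b-a)) and 1. *)
Lemma energy_increment_bounds (a b : R) : 0 <= a -> a <= b ->
  expR (- 2 * (b - a)) * \int[mu]_(s in `[a, b]) (sigma s ^+ 2) <=
    energy b - expR (- 2 * (b - a)) * energy a <=
    \int[mu]_(s in `[a, b]) (sigma s ^+ 2).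
Proof.
move=> a0 ab; rewrite (energy_split a0 ab) addrAC subrr add0r.
have si := within_itv0y_integrable b sqr_sigma_cont a0.
have wi := within_itv0y_integrable b (@weighted_sqr_sigma_cont b) a0.
apply/andP; split; last first.
  apply: le_Rintegral => // s; rewrite /= in_itv/= => /andP[as_ sb].
  by rewrite ler_piMl ?sqr_ge0//; case/andP: (expR_decay as_ sb).
rewrite -RintegralZl//; apply: le_Rintegral => //.
  apply: within_itv0y_integrable => //.
  apply: (within_continuousM _ sqr_sigma_cont).
  exact/continuous_subspaceT/cst_continuous.
move=> s; rewrite /= in_itv/= => /andP[as_ sb].
by rewrite ler_wpM2r ?sqr_ge0//; case/andP: (expR_decay as_ sb).
Qed.

Lemma theta_sqE n :
  theta sigma n ^+ 2 = \int[mu]_(s in `[n%:R, n.+1%:R]) (sigma s ^+ 2).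
Proof. by rewrite sqr_sqrtr//; apply: Rintegral_ge0 => s _; exact: sqr_ge0. Qed.

Lemma Sigma_sqE t : 1 <= t -> Sigma sigma t ^+ 2 = energy t * ln t.
Proof.
by move=> t1; rewrite exprMn !sqr_sqrtr ?ln_ge0//; exact: energy_ge0.
Qed.

Lemma Theta_sq_ge0 n : 0 <= Theta_sq sigma n.
Proof. by apply: sumr_ge0 => j _; rewrite mulr_ge0 ?expR_ge0 ?sqr_ge0. Qed.

Lemma Theta_sqS n :
  Theta_sq sigma n.+1 = expR (- 2) * (Theta_sq sigma n + theta sigma n ^+ 2).
Proof.
rewrite /Theta_sq big_nat_recr//= [RHS]mulrDr mulr_sumr.
congr (_ + _); last first.
  by congr (expR _ * _); rewrite -natr1; ring.
by apply: eq_bigr => j _; rewrite mulrA -expRD -natr1; congr (expR _ * _); ring.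
Qed.

Lemma energyS_bounds n :
  expR (- 2) * theta sigma n ^+ 2 <=
    energy n.+1%:R - expR (- 2) * energy n%:R <= theta sigma n ^+ 2.
Proof.
have := @energy_increment_bounds n%:R n.+1%:R (ler0n _ _).
rewrite ler_nat => /(_ (leqnSn _)).
by rewrite -theta_sqE -[n.+1%:R]natr1 (addrC _ 1) addrK mulr1.
Qed.

(** Induction on n: both sequences start at 0 and decay by exp(-2) per step. The input theta^2(n)
    enters [Theta_sq] with weight exp(-2) and [energy] with a weight between exp(-2) and 1, so the
    ratio stays between 1 and exp(2). *)
Lemma Theta_sq_energy n :
  Theta_sq sigma n <= energy n%:R <= expR 2 * Theta_sq sigma n.
Proof.
elim: n => [|n /andP[IH1 IH2]].
  by rewrite /Theta_sq big_geq// /energy set_itv1 Rintegral_set1 mulr0 lexx.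
have /andP[h1 h2] := energyS_bounds n; rewrite Theta_sqS.
have e0 : 0 < expR (- 2) :> R by exact: expR_gt0.
have -> : forall z, expR 2 * (expR (- 2) * z) = z :> R.
  by move=> z; rewrite mulrA -expRD subrr expR0 mul1r.
have k1 := ler_wpM2l (ltW e0) IH1.
have k2 := ler_wpM2l (ltW e0) IH2.
rewrite mulrA -expRD addrC subrr expR0 mul1r in k2.
apply/andP; split; lra.
Qed.

(** Dropping the nonnegative input on [a, b] leaves pure decay, by at most exp(-2) as b - a <= 1. *)
Lemma energy_growth (a b : R) : 0 <= a -> a <= b -> b <= a + 1 ->
  energy a <= expR 2 * energy b.
Proof.
move=> a0 ab ba.
have e2 : expR (- 2) <= expR (- 2 * (b - a)) by rewrite ler_expR; lra.
have i0 : 0 <= \int[mu]_(s in `[a, b]) (sigma s ^+ 2).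
  by apply: Rintegral_ge0 => s _; exact: sqr_ge0.
have /andP[+ _] := energy_increment_bounds a0 ab.
move=> /(le_trans (mulr_ge0 (expR_ge0 _) i0)); rewrite subr_ge0 => h.
rewrite -(ler_pM2l (expR_gt0 (- 2))) [leRHS]mulrA -expRD addrC subrr.
rewrite expR0 mul1r; apply: le_trans h.
by rewrite ler_wpM2r ?energy_ge0.
Qed.

End energy.

Lemma cvg_truncn_infty (R : realType) :
  (fun t : R => Num.truncn t) @ +oo%R --> \oo.
Proof.
move=> P [N _ NP]; exists N%:R; split=> // t /ltW Nt /=; apply: NP => /=.
by rewrite truncn_ge_nat// (le_trans _ Nt).
Qed.

(** * Pointwise inequalities between Sigma^2, Theta^2 log and theta^2 log *)

Section relations.
Context {R : realType} (sigma : R -> R).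
Hypothesis sigma_cont : {within `[0, +oo[, continuous sigma}.

Let e2 : R := expR 2.
Let S_ (t : R) := Sigma sigma t ^+ 2.
Let S n := Sigma sigma n%:R ^+ 2.
Let x n := Theta_sq sigma n * ln (n%:R : R).
Let y n := theta sigma n ^+ 2 * ln (n%:R : R).

Lemma ln_nat_ge0 n : 0 <= ln (n%:R : R).
(* The default value ln 0 = 0 settles [n = 0]. *)
Proof. by case: n => [|n]; [rewrite ln0|rewrite ln_ge0// ler1n]. Qed.

Lemma ler_ln_nat m n : (m <= n)%N -> ln (m%:R : R) <= ln (n%:R : R).
Proof.
case: m => [_|m mn]; first by rewrite ln0// ln_nat_ge0.
by rewrite ler_ln ?posrE ?ltr0n ?(leq_trans _ mn)// ler_nat.
Qed.

Let e2M z : e2 * (expR (- 2) * z) = z.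
Proof. by rewrite mulrA -expRD subrr expR0 mul1r. Qed.

Lemma Theta_Sigma n : (0 < n)%N -> x n <= S n <= e2 * x n.
Proof.
move=> n0; have /andP[h1 h2] := Theta_sq_energy sigma_cont n.
rewrite /S Sigma_sqE ?ler1n// /x mulrA.
by rewrite !ler_wpM2r ?ln_nat_ge0.
Qed.

(** Keep only the newest term in [Theta_sqS], and use that the logarithm increases. *)
Lemma theta_ThetaS n : y n <= e2 * x n.+1.
Proof.
rewrite /x Theta_sqS -mulrA e2M ler_pM ?ln_nat_ge0 ?sqr_ge0 ?ler_ln_nat//.
by rewrite lerDr Theta_sq_ge0.
Qed.

Lemma ThetaS_average n : (1 < n)%N -> x n.+1 <= (x n + y n) / 2.
Proof.
move=> n1; rewrite /x /y -mulrDl Theta_sqS.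
set a := _ + _; have a0 : 0 <= a by rewrite addr_ge0 ?Theta_sq_ge0 ?sqr_ge0.
(* For n >= 2, n + 1 <= 2 n <= n^2. *)
have lnS : ln (n.+1%:R : R) <= 2 * ln (n%:R : R).
  rewrite mulr_natl -lnXn ?ltr0n ?(ltnW n1)// -natrX ler_ln_nat//.
  rewrite -mulnn (leq_trans _ (leq_mul n1 (leqnn n)))//.
  by rewrite mul2n -addnn -addn1 leq_add2l ltnW.
(* From 1 + x <= exp x at x = 1, exp 1 >= 2 and so exp 2 >= 4. With [lnS] the total factor is at
   most 2/4 = 1/2. *)
have e4 : expR (- 2) <= 4^-1 :> R.
  rewrite expRN lef_pV2 ?posrE ?expR_gt0//.
  have -> : expR 2 = expR 1 ^+ 2 :> R by rewrite -expRM_natl mulr1.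
  have := @expR_ge1Dx R 1.
  rewrite expr2 => h.
  have : (2 : R) * 2 <= expR 1 * expR 1 by rewrite ler_pM//; lra.
  lra.
have h1 := ler_pM (expR_ge0 (- 2)) (ln_nat_ge0 n.+1) e4 lnS.
rewrite -[leLHS]mulrA mulrCA -mulrA ler_wpM2l//; apply: le_trans h1 _; lra.
Qed.

(** [energy_growth] bounds an earlier value by a later one. It is applied on [n, t] and on [t, n+1],
    with n the integer part of t; the logarithm is monotone in the same direction. *)
Lemma Sigma_trunc (t : R) : 1 <= t ->
  S (Num.truncn t) <= e2 * S_ t /\ S_ t <= e2 * S (Num.truncn t).+1.
Proof.
move=> t1; have t0 : 0 <= t by exact: le_trans t1.
have /andP[nt tn] := truncn_itv t0; set n := Num.truncn t in nt tn *.
have n0 : (0 < n)%N by rewrite truncn_gt0.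
have {tn} nS : t <= n.+1%:R := ltW tn.
rewrite /S /S_ !Sigma_sqE ?ler1n// !mulrA; split.
  apply: ler_pM; rewrite ?energy_ge0 ?ln_nat_ge0//.
    by apply: energy_growth => //; rewrite natr1.
  by rewrite ler_ln// posrE ?ltr0n// (lt_le_trans ltr01).
apply: ler_pM; rewrite ?energy_ge0 ?ln_ge0//.
  by apply: energy_growth => //; rewrite -natr1 lerD2r.
by rewrite ler_ln// posrE ?ltr0n// (lt_le_trans ltr01).
Qed.

End relations.

(** * Dominance relations among the three quantities, and convergence of S' *)

Section dominances.
Context {R : realType} (sigma : R -> R).
Hypothesis sigma_cont : {within `[0, +oo[, continuous sigma}.

Let S_ (t : R) := Sigma sigma t ^+ 2.
Let S n := Sigma sigma n%:R ^+ 2.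
Let x n := Theta_sq sigma n * ln (n%:R : R).
Let y n := theta sigma n ^+ 2 * ln (n%:R : R).

Let near_ge (N : nat) : \forall n \near \oo, (N <= n)%N.
Proof. by exists N. Qed.

Let near_truncn (P : nat -> Prop) : (\forall n \near \oo, P n) ->
  \forall t \near +oo, P (Num.truncn (t : R)) /\ 1 <= t.
Proof.
move=> /(@cvg_truncn_infty R)[M [_ MP]]; exists (Num.max M 1).
by split=> [|t]; rewrite ?num_real// gt_max => /andP[/MP Mt /ltW].
Qed.

Let near_natr (P : R -> Prop) :
  (\forall t \near +oo, P t) -> \forall n \near \oo, P n%:R.
Proof. by move=> /cvgr_idn. Qed.

Lemma limsup_Sigma_nat : limsup_dominated \oo S (pinfty_nbhs R) S_.
Proof.
by exists 1 => // c _ /near_natr; apply: filterS => n; rewrite mul1r.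
Qed.

Lemma liminf_Sigma_nat : liminf_dominated (pinfty_nbhs R) S_ \oo S.
Proof.
by exists 1 => // c _ /near_natr; apply: filterS => n; rewrite mul1r.
Qed.

Lemma limsup_Sigma_real : limsup_dominated (pinfty_nbhs R) S_ \oo S.
Proof.
(* [near_S] is needed because the value at t is bounded by the value at the integer after it. *)
exists (expR 2) => [|c _ /near_S/near_truncn]; first exact: expR_gt0.
apply: filterS => t [Sc t1]; have [_ /le_trans] := Sigma_trunc sigma_cont t1.
by apply; rewrite ler_pM2l ?expR_gt0.
Qed.

Lemma liminf_Sigma_real : liminf_dominated \oo S (pinfty_nbhs R) S_.
Proof.
exists (expR (- 2)) => [|c _ /near_truncn]; first exact: expR_gt0.
apply: filterS => t [Sc t1]; have [] := Sigma_trunc sigma_cont t1.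
by move=> /(le_trans Sc); rewrite expRN ler_pdivrMl ?expR_gt0.
Qed.

Lemma liminf_Theta_Sigma : liminf_dominated \oo x \oo S.
Proof.
exists 1 => // c _ xc; apply: filterS2 (near_ge 1) xc => n n1 cx.
by rewrite mul1r; case/andP: (Theta_Sigma sigma_cont n1) => /(le_trans cx).
Qed.

Lemma liminf_Sigma_Theta : liminf_dominated \oo S \oo x.
Proof.
exists (expR (- 2)) => [|c _ Sc]; first exact: expR_gt0.
apply: filterS2 (near_ge 1) Sc => n n1 cS.
case/andP: (Theta_Sigma sigma_cont n1) => _ /(le_trans cS).
by rewrite expRN ler_pdivrMl ?expR_gt0.
Qed.

Lemma limsup_Theta_theta : limsup_dominated \oo x \oo y.
Proof.
exists 2 => // c c0; apply: averaging_near_le => //.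
by apply: filterS (near_ge 2) => n; exact: ThetaS_average.
Qed.

Lemma limsup_Sigma_theta : limsup_dominated \oo S \oo y.
Proof.
have [K K0 xy] := limsup_Theta_theta.
exists (expR 2 * K) => [|c c0 /(xy _ c0) xc].
  by rewrite mulr_gt0 ?expR_gt0.
apply: filterS2 (near_ge 1) xc => n n1 xc.
case/andP: (Theta_Sigma sigma_cont n1) => _ /le_trans; apply.
by rewrite -mulrA ler_pM2l ?expR_gt0.
Qed.

(** The chain y(n) <= exp(2) x(n+1) <= exp(2) S(n+1), with its shift of index. *)
Lemma limsup_theta_Sigma : limsup_dominated \oo y \oo S.
Proof.
exists (expR 2) => [|c _ /near_S]; first exact: expR_gt0.
apply: filterS => n Sc; apply: le_trans (theta_ThetaS sigma n) _.
rewrite ler_pM2l ?expR_gt0//.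
by case/andP: (Theta_Sigma sigma_cont (ltn0Sn n)) => /le_trans + _; exact.
Qed.

Lemma liminf_theta_Theta : liminf_dominated \oo y \oo x.
Proof.
exists (expR (- 2)) => [|c _ [N _ yc]]; first exact: expR_gt0.
exists N.+1 => // -[//|n] /= Nn.
by rewrite expRN ler_pdivrMl ?expR_gt0// (le_trans (yc n Nn))// theta_ThetaS.
Qed.

Lemma Sprime_lty (M eps : R) : 0 < M -> 4 * M <= eps ^+ 2 ->
  (\forall n \near \oo, y n <= M) -> (Sprime sigma eps < +oo)%E.
Proof.
move=> M0 Meps yM; rewrite /Sprime; apply: nneseries_near_le_invsq => [n|].
  by case: ifP => // _; rewrite mulr_ge0 ?sqrtr_ge0 ?expR_ge0.
have lnM : \forall n \near \oo, M <= ln (n%:R : R).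
  exists (Num.truncn (expR M)).+1 => // n /= Mn.
  rewrite -[M]expRK ler_ln ?posrE ?expR_gt0 ?ltr0n//; last exact: leq_trans Mn.
  by rewrite ltW// (lt_le_trans (truncnS_gt _))// ler_nat.
near=> n.
have n0 : (0 < n)%N by near: n; exact: near_ge.
case: ifPn => [_|th0]; first by rewrite invr_ge0 exprn_ge0.
have th : 0 < theta sigma n by rewrite lt0r th0 sqrtr_ge0.
have Mn : M <= ln (n%:R : R) by near: n.
have yn : y n <= M by near: n.
have th1 : theta sigma n <= 1.
  rewrite -(@expr_le1 _ 2)//; last exact: ltW.
  rewrite -(ler_pM2r (lt_le_trans M0 Mn)) mul1r.
  exact: le_trans yn Mn.
rewrite -[leRHS]mul1r; apply: ler_pM; rewrite ?expR_ge0 ?(ltW th)//.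
(* Writing n^(-2) as exp(-2 ln n) reduces the claim to 2 theta^2(n) ln n <= eps^2 / 2, which follows
   from [y n <= M] and 4 M <= eps^2. *)
rewrite -[in leRHS](@lnK _ n%:R) ?posrE ?ltr0n// -expRM_natl -expRN ler_expR.
rewrite mulNr lerN2 mul1r ler_pdivlMr ?exprn_gt0//.
have : 2 * (ln n%:R * theta sigma n ^+ 2) <= 2 * M by rewrite ler_pM2l// mulrC.
rewrite mulrA; lra.
Unshelve. all: by end_near. Qed.

End dominances.

(** * The four equivalences and their consequences, assembled from the dominances *)

Theorem proposition4 (R : realType) (sigma : R -> R)
    (sigma_cont : {within `[0, +oo[, continuous sigma}) :
  (* (i) *)
  (let A := Sigma sigma t ^+ 2 @[t --> +oo] --> (0 : R) in
   let B := Sigma sigma n%:R ^+ 2 @[n --> \oo] --> (0 : R) in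
   let C := theta sigma n ^+ 2 * ln (n%:R : R) @[n --> \oo] --> (0 : R) in
   [/\ A <-> B, A <-> C &
       A \/ B \/ C -> forall eps : R, 0 < eps -> (Sprime sigma eps < +oo)%E])
  /\
  (* (ii) *)
  (let A := (0 < limf_esup (fun t : R => (Sigma sigma t ^+ 2)%:E)
                   (pinfty_nbhs R) < +oo)%E in
   let B := (0 < limn_esup (fun n => (Sigma sigma n%:R ^+ 2)%:E) < +oo)%E in
   let C := (0 < limn_esup (fun n =>
                   (theta sigma n ^+ 2 * ln (n%:R : R))%:E) < +oo)%E in
   [/\ A <-> B, A <-> C &
       A \/ B \/ C -> exists2 eps' : R, 0 < eps' &
         forall eps : R, eps' < eps -> (Sprime sigma eps < +oo)%E])
  /\
  (* (iii) *)
  (let A := (0 < limf_einf (fun t : R => (Sigma sigma t ^+ 2)%:E)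
                   (pinfty_nbhs R) < +oo)%E in
   let B := (0 < limn_einf (fun n => (Sigma sigma n%:R ^+ 2)%:E) < +oo)%E in
   let C := (0 < limn_einf (fun n =>
                   (Theta_sq sigma n * ln (n%:R : R))%:E) < +oo)%E in
   [/\ A <-> B, A <-> C &
       A \/ B \/ C ->
       (0 <= limn_einf (fun n =>
               (theta sigma n ^+ 2 * ln (n%:R : R))%:E) < +oo)%E])
  /\
  (* (iv) *)
  (let A := Sigma sigma t ^+ 2 @[t --> +oo] --> +oo in
   let B := Sigma sigma n%:R ^+ 2 @[n --> \oo] --> +oo in
   let C := Theta_sq sigma n * ln (n%:R : R) @[n --> \oo] --> +oo in
   [/\ A <-> B, A <-> C &
       A \/ B \/ C ->
       limn_esup (fun n => (theta sigma n ^+ 2 * ln (n%:R : R))%:E) = +oo%E]).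
Proof.
have AB := limsup_Sigma_real sigma_cont; have BA := limsup_Sigma_nat sigma.
have BC := limsup_Sigma_theta sigma_cont.
have CB := limsup_theta_Sigma sigma_cont.
have lAB := liminf_Sigma_nat sigma; have lBA := liminf_Sigma_real sigma_cont.
have lBC := liminf_Sigma_Theta sigma_cont.
have lCB := liminf_Theta_Sigma sigma_cont.
have S0 (t : R) : 0 <= Sigma sigma t ^+ 2 by exact: sqr_ge0.
have y0 n : 0 <= theta sigma n ^+ 2 * ln (n%:R : R).
  by rewrite mulr_ge0 ?sqr_ge0 ?ln_nat_ge0.
split; [|split; [|split]] => A B C.
(* In all four parts, the conditions are first put in eventual-bound form, and A is linked to C
   through B. *)
- have EA : A <-> _ := cvg_ge0_0P (nearW _ S0).
  have EB : B <-> _ := cvg_ge0_0P (nearW _ (fun n => S0 n%:R)).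
  have EC : C <-> _ := cvg_ge0_0P (nearW _ y0).
  have iAB : A <-> B.
    by split=> [/EA/(limsup_dominated_lim0 BA)/EB|
                /EB/(limsup_dominated_lim0 AB)/EA].
  have iBC : B <-> C.
    by split=> [/EB/(limsup_dominated_lim0 CB)/EC|
                /EC/(limsup_dominated_lim0 BC)/EB].
  split=> //; first by rewrite iAB.
  move=> ABC eps e0; have /EC yc : C by case: ABC => [/iAB/iBC|[/iBC|]].
  (* The largest M that [Sprime_lty] admits for this eps; convergence to 0 supplies the bound. *)
  have M0 : 0 < eps ^+ 2 / 4 by rewrite divr_gt0 ?exprn_gt0.
  by apply: (Sprime_lty M0 _ (yc _ M0)); rewrite mulrC divfK.
- have EA : A <-> _ := limf_esup_gt0_ltyP _.
  have EB : B <-> _ := limf_esup_gt0_ltyP _.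
  have EC : C <-> _ := limf_esup_gt0_ltyP _.
  have iAB : A <-> B.
    by rewrite EA EB; exact: limsup_dominated_pos_bounded.
  have iBC : B <-> C.
    by rewrite EB EC; exact: limsup_dominated_pos_bounded.
  split=> //; first by rewrite iAB.
  move=> ABC; have /EC[_ [M M0 yM]] : C by case: ABC => [/iAB/iBC|[/iBC|]].
  (* This threshold works because (M + 1)^2 - 4 M = (M - 1)^2 >= 0. *)
  exists (M + 1) => [|eps Meps]; first by rewrite addr_gt0.
  apply: (Sprime_lty M0 _ yM); apply: (@le_trans _ _ ((M + 1) ^+ 2)).
    by have := sqr_ge0 (M - 1); rewrite !expr2; lra.
  have M1 : 0 <= M + 1 by rewrite addr_ge0// ltW.
  by rewrite ler_pXn2r ?nnegrE ?(le_trans M1 (ltW Meps))// ltW.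
- have EA : A <-> _ := limf_einf_gt0_ltyP _.
  have EB : B <-> _ := limf_einf_gt0_ltyP _.
  have EC : C <-> _ := limf_einf_gt0_ltyP _.
  have iAB : A <-> B.
    by rewrite EA EB; exact: liminf_dominated_pos_bounded.
  have iBC : B <-> C.
    by rewrite EB EC; exact: liminf_dominated_pos_bounded.
  split=> //; first by rewrite iAB.
  move=> ABC; have /EC[_ xM] : C by case: ABC => [/iAB/iBC|[/iBC|]].
  apply/andP; split.
    by apply: limf_einf_near_ge; apply: nearW => n; rewrite lee_fin.
  (* If theta^2(n) log n tended to infinity, so would Theta^2(n) log n. *)
  apply/limf_einf_ltyP => yM; apply: xM.
  exact: liminf_dominated_limy (liminf_theta_Theta sigma) yM.
- have EA : A <-> _ := cvgry_gt0P _.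
  have EB : B <-> _ := cvgry_gt0P _.
  have EC : C <-> _ := cvgry_gt0P _.
  have iAB : A <-> B.
    by split=> [/EA/(liminf_dominated_limy lAB)/EB|
                /EB/(liminf_dominated_limy lBA)/EA].
  have iBC : B <-> C.
    by split=> [/EB/(liminf_dominated_limy lBC)/EC|
                /EC/(liminf_dominated_limy lCB)/EB].
  split=> //; first by rewrite iAB.
  move=> ABC; have /EC xy : C by case: ABC => [/iAB/iBC|[/iBC|]].
  (* A finite limsup would bound theta^2(n) log n, hence by averaging Theta^2(n) log n by some M,
     although the latter eventually exceeds M + 1 or equals it. *)
  apply/eqP; rewrite -leye_eq leNgt; apply/negP => /limf_esup_ltyP.
  move=> /(limsup_dominated_bounded (limsup_Theta_theta sigma))[M M0 xM].
  have M1 : 0 < M + 1 by rewrite addr_gt0.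
  have [n [Mx]] := filter_ex (filterI (xy _ M1) xM).
  by rewrite /= => /(le_trans Mx); rewrite gerDl ler10.
Qed.
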